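(* Let $n\geq 2$ and let $\{X_i:i\in[k]\}$ be a family of signed sets from $\mathcal{Z}_n$ such that there do not exist indices $a,b,c,d\in[k]$ with $\{a,b\}\cap\{c,d\}=\emptyset$ and $(X_a^+\cup X_c^+)\cap(X_b^-\cup X_d^-)=\emptyset$. Then $k\leq\binom{n+2}{\lfloor(n+2)/2\rfloor}$, with equality if and only if $\{X_i:i\in[k]\}$ consists either of all $X\in\mathcal{Z}_n$ with $X^0=\emptyset$ and $|X^+|\in\{\lfloor(n+1)/2\rfloor,\lfloor(n+1)/2\rfloor+1\}$, or of all $X\in\mathcal{Z}_n$ with $X^0=\emptyset$ and $|X^+|\in\{\lceil(n+1)/2\rceil-1,\lceil(n+1)/2\rceil\}$ (each such $X$ occurring exactly once).
   Context: $[k]=\{1,\dots,k\}$. A signed subset of $[n+1]$ is a vector $X\in\{0,\pm1\}^{n+1}$; $X^+=\{i:X(i)=1\}$, $X^-=\{i:X(i)=-1\}$, $X^0=\{i:X(i)=0\}$; $\emptyset$ also denotes the empty signed set (the zero vector). $\mathcal{Z}_n=\{X\in\{0,\pm1\}^{n+1}:X^+\neq\emptyset,\ X^-\neq\emptyset\}\cup\{\emptyset\}$. The family is indexed, so repetitions are a priori allowed. *)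

(* Defs.v *)
(* Mathematical Components *)
From mathcomp Require Import all_boot all_order all_algebra.

Set Implicit Arguments.
Unset Strict Implicit.
Unset Printing Implicit Defensive.

Local Open Scope ring_scope.

Section SignedSets.

Variable n : nat.
Implicit Type X : 'rV[int]_n.+1.

Definition signed_set X : bool := [forall i, X 0 i \in [:: 0; 1; -1]].

Definition pos_part X : {set 'I_n.+1} := [set i | X 0 i == 1].
Definition neg_part X : {set 'I_n.+1} := [set i | X 0 i == -1].
Definition zero_part X : {set 'I_n.+1} := [set i | X 0 i == 0].

Definition Zn : pred 'rV[int]_n.+1 :=
  [pred X | signed_set X
    & (pos_part X != set0) && (neg_part X != set0) || (X == 0)].

Definition two_levels (r s : nat) : pred 'rV[int]_n.+1 :=
  [pred X | [&& X \in Zn, zero_part X == set0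
    & #|pos_part X| \in [:: r; s]]].

(* The indices a, b (and likewise c, d) need not be distinct: only the index
   sets {a, b} and {c, d} must be disjoint. *)
Definition admissible k (X : 'I_k -> 'rV[int]_n.+1) : Prop :=
  ~ exists a b c d : 'I_k,
      [set a; b] :&: [set c; d] = set0 /\
      (pos_part (X a) :|: pos_part (X c))
        :&: (neg_part (X b) :|: neg_part (X d)) = set0.

(* Injectivity encodes that each vector satisfying P occurs exactly once. *)
Definition consists_of k (X : 'I_k -> 'rV[int]_n.+1)
    (P : pred 'rV[int]_n.+1) : Prop :=
  injective X /\ codom X =i P.

End SignedSets.

Arguments Zn n : clear implicits.
Arguments two_levels n : clear implicits.

(* Main.v *)
(* Bollobas-type permutation method. Put A_i = X_i^+, B_i = X_i^-, N = n + 1,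
   h = N / 2, W = C(N, h), W' = C(N, h + 1). Say that i lies on a permutation p
   of the ground set if p puts A_i entirely before B_i. At most two indices lie on
   p, and i lies on N! / C(|A_i| + |B_i|, |A_i|) of the N! permutations, so
   sum_i 1 / C(|A_i| + |B_i|, |A_i|) <= 2. The binomial coefficient is W for the
   full pairs with |A_i| = h, of which there are at most W, and at most W' for all
   the others; this gives k <= W + W' = C(n + 2, (n + 2) / 2).
   In the case of equality every X_i is full with |A_i| in {h, h + 1, N - h - 1}
   and exactly two indices lie on each p. For N even this last fact shows that as
   soon as one set of size h - 1 occurs all of them do, and then no set of size
   h + 1 can occur. *)
Require Import Defs.
From mathcomp Require Import all_boot all_order all_algebra all_fingroup.
From mathcomp Require Import zify ring.

Set Implicit Arguments.
Unset Strict Implicit.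
Unset Printing Implicit Defensive.

(** Induction on the size of [S' :\: S]: equal cardinalities supply an [x] in [S :\: S'] to trade
    for a [y] in [S' :\: S], which shrinks that difference. *)
Lemma swap_ind (T : finType) (U : {set T}) (P : {set T} -> Prop) :
  (forall (S : {set T}) x y, S \subset U -> x \in S -> y \in U -> y \notin S ->
     P S -> P (y |: S :\ x)) ->
  forall S S' : {set T}, S \subset U -> S' \subset U -> #|S| = #|S'| ->
  P S -> P S'.
Proof.
move=> swapP S S' sSU sS'U eqSS'; move: {2}_.+1 (ltnSn #|S' :\: S|) => m.
elim: m => // m IHm in S sSU eqSS' *; rewrite ltnS => le_m PS.
have [/eqP/[!setD_eq0] sS'S | [y]] := set_0Vmem (S' :\: S).
  by have /eqP -> : S' == S by rewrite eqEcard sS'S eqSS' /=.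
rewrite inE => /andP[yS yS'].
have [/eqP/[!setD_eq0] sSS' | [x]] := set_0Vmem (S :\: S').
  have /eqP eS : S == S' by rewrite eqEcard sSS' eqSS' /=.
  by rewrite eS yS' in yS.
rewrite inE => /andP[xS' xS].
have yU : y \in U by apply: (subsetP sS'U).
have ySx : y \notin S :\ x by rewrite inE negb_and yS orbT.
apply: (IHm (y |: S :\ x)); last exact: swapP.
- by rewrite subUset sub1set yU (subset_trans (subsetDl _ _)).
- by rewrite cardsU1 ySx -eqSS' (cardsD1 x S) xS.
rewrite (leq_trans _ le_m) // (cardsD1 y (S' :\: S)) inE yS yS' /= ltnS.
apply: subset_leq_card; apply/subsetP => z; rewrite !inE.
by case: (z =P y) => //= _; case: (z =P x) => //= ->; rewrite (negPf xS').
Qed.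

(** * Permutations that put one set before another *)

Section Before.

Variable N : nat.
Implicit Types (p s : {perm 'I_N}) (A B S U : {set 'I_N}).

Definition before p A B := [forall x in A, forall y in B, p x < p y].

Lemma beforeP p A B :
  reflect {in A & B, forall x y, p x < p y} (before p A B).
Proof.
apply: (iffP forall_inP) => [H x y xA yB|H x xA].
  by move/forall_inP: (H x xA); apply.
by apply/forall_inP => y; apply: H.
Qed.

Lemma before_imset s p A B :
  before p (s @: A) (s @: B) = before (s * p)%g A B.
Proof.
apply/beforeP/beforeP => H x y.
  by move=> xA yB; rewrite !permM; apply: H; apply: imset_f.
by case/imsetP=> a aA -> /imsetP[b bB ->]; move: (H a b aA bB); rewrite !permM.
Qed.

Lemma card_before_imset s A B :
  #|[set p | before p (s @: A) (s @: B)]| = #|[set p | before p A B]|.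
Proof.
rewrite -(card_preimset [set p | before p A B] (mulgI s)).
by apply: eq_card => p; rewrite !inE before_imset.
Qed.

Lemma initial_exists p U a :
  a <= #|U| -> exists2 S : {set 'I_N}, (S \subset U) && (#|S| == a) &
    before p S (U :\: S).
Proof.
elim: a => [_|a IHa lt_a].
  exists set0; first by rewrite sub0set cards0.
  by apply/beforeP => x y; rewrite inE.
have [S /andP[sSU /eqP cS] /beforeP bS] := IHa (ltnW lt_a).
have [/eqP/[!setD_eq0] sUS | [x0 x0D]] := set_0Vmem (U :\: S).
  by have := subset_leq_card sUS; rewrite cS leqNgt lt_a.
have [x xD xmin] := arg_minnP (fun x => p x : nat) x0D.
have : x \in U :\: S by [].
rewrite inE => /andP[xS xU].
exists (x |: S).
  by rewrite subUset sub1set xU sSU cardsU1 xS cS /=.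
apply/beforeP => y z; rewrite !inE negb_or => yS /andP[/andP[zx zS] zU].
have zD : z \in U :\: S by rewrite inE zS.
case/orP: yS => [/eqP-> | yS]; last exact: bS.
rewrite ltn_neqAle xmin // andbT; apply: contra zx => /eqP e.
by apply/eqP/esym/(@perm_inj _ p)/val_inj.
Qed.

(** Otherwise some [x] in [S :\: S'] and [y] in [S' :\: S] would precede each other. *)
Lemma initial_unique p U S S' :
  S \subset U -> S' \subset U -> #|S| = #|S'| ->
  before p S (U :\: S) -> before p S' (U :\: S') -> S = S'.
Proof.
move=> sSU sS'U eqSS' /beforeP bS /beforeP bS'; apply/eqP.
have [/eqP/[!setD_eq0] sSS' | [x]] := set_0Vmem (S :\: S').
  by rewrite eqEcard sSS' eqSS' /=.
have [/eqP/[!setD_eq0] sSS' | [y]] := set_0Vmem (S' :\: S).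
  by rewrite eq_sym eqEcard sSS' eqSS' /=.
rewrite !inE => /andP[yS yS'] /andP[xS' xS].
have := bS x y xS; rewrite inE yS (subsetP sS'U) // => /(_ isT).
have := bS' y x yS'; rewrite inE xS' (subsetP sSU) // => /(_ isT).
by move=> lt1 /(ltn_trans lt1); rewrite ltnn.
Qed.

(* Each p puts exactly one #|A|-subset of U := A :|: B first, and by symmetry
   all these subsets are equally frequent. *)
Lemma card_before A B :
  [disjoint A & B] ->
  #|[set p | before p A B]| * 'C(#|A| + #|B|, #|A|) = N`!.
Proof.
move=> dAB; set U := A :|: B; set a := #|A|.
have sAU : A \subset U by apply: subsetUl.
have cU : #|U| = a + #|B| by rewrite cardsU disjoint_setI0 // cards0 subn0.
have eB : B = U :\: A.
  rewrite setDUl setDv set0U; apply/esym/setDidPl.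
  by rewrite disjoint_sym.
pose c S := #|[set p | before p S (U :\: S)]|.
have cE S : S \subset U -> #|S| = a -> c S = c A.
  move=> sSU cS; apply: (@swap_ind _ U (fun S => c S = c A) _ A) => //.
  move=> {sSU cS}S x y sSU xS yU yS <-.
  have xU := subsetP sSU x xS.
  have xy : x != y by apply: contraNneq yS => <-.
  (* The exchange of [x] for [y] is the action of a transposition that preserves [U], so
     [card_before_imset] applies. *)
  have eS : y |: S :\ x = tperm x y @: S.
    apply/setP=> z; rewrite -[z in RHS](tpermK x y) (mem_imset _ _ perm_inj) !inE.
    case: tpermP => [->|->|/eqP zx /eqP zy]; rewrite ?eqxx ?xS //=.
    - by rewrite (negPf xy) (negPf yS).
    - by rewrite zx (negPf zy).
  have eU : U = tperm x y @: U.
    apply/setP=> z; rewrite -[z in RHS](tpermK x y) (mem_imset _ _ perm_inj).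
    by case: tpermP => [->|->|//]; rewrite xU yU.
  have eD : U :\: (y |: S :\ x) = tperm x y @: (U :\: S).
    apply/setP=> z; rewrite eS {1}eU -(tpermK x y z) in_setD.
    by rewrite !(mem_imset _ _ perm_inj) in_setD.
  by rewrite /c eD eS card_before_imset.
rewrite -cU -cards_draws {1}eB -/(c A) mulnC -sum_nat_const.
rewrite -card_Sn -sum1_card.
transitivity (\sum_(S in [set S : {set 'I_N} | S \subset U & #|S| == a])
                \sum_(p | before p S (U :\: S)) 1).
  apply: eq_bigr => S /[!inE] /andP[sSU /eqP cS].
  by rewrite sum1dep_card -/(c S) cE.
rewrite (exchange_big_dep predT) //=; apply: eq_bigr => p _.
rewrite sum1dep_card.
have [S /andP[sSU /eqP cS] bS] := @initial_exists p U a (subset_leq_card sAU).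
apply/eqP/cards1P; exists S; apply/setP=> S'; rewrite !inE.
apply/andP/eqP => [[/andP[sS'U /eqP cS'] bS']|->]; last by rewrite sSU cS /=.
by apply: (initial_unique sS'U sSU _ bS' bS); rewrite cS.
Qed.

(** The image of [x] is its index in the enumeration of the ground set sorted by [f]. *)
Lemma perm_sorting (f : 'I_N -> nat) :
  exists p, forall x y, f x < f y -> p x < p y.
Proof.
pose r := relpre f leq; pose s := sort r (enum 'I_N).
have rT : transitive r by move=> ? ? ?; apply: leq_trans.
have ss : sorted r s by apply: sort_sorted => x y; apply: leq_total.
have mems x : x \in s by rewrite mem_sort mem_enum.
have lt_s x : index x s < N.
  by rewrite -[ltnRHS](size_enum_ord N) -(size_sort r) index_mem.
have inj : injective (fun x => Ordinal (lt_s x)).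
  move=> x y [] /(congr1 (nth x s)).
  by rewrite !nth_index.
exists (perm inj) => x y fxy; rewrite !permE /= ltnNge; apply/negP => le_yx.
have := sorted_leq_index rT (fun x => leqnn (f x)) ss _ _ (mems y) (mems x) le_yx.
by rewrite /r /= leqNgt fxy.
Qed.

Lemma perm_through (S U : {set 'I_N}) :
  S \subset U -> exists p, before p S (~: S) && before p U (~: U).
Proof.
(* The sorting key is 0 on [S], 1 on [U :\: S] and 2 outside [U]. *)
move=> sSU; have [p Hp] := perm_sorting (fun x => (x \notin S) + (x \notin U)).
exists p; apply/andP; split; apply/beforeP => x y xS; rewrite inE => yS.
  apply: Hp; rewrite xS (subsetP sSU x xS) yS; lia.
apply: Hp; rewrite xS yS (contra (subsetP sSU y)) //=; lia.
Qed.

End Before.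

(** * The largest and second largest binomial coefficients of a row *)

Lemma ltn_bin_half N a b : a < b -> b <= N./2 -> 'C(N, a) < 'C(N, b).
Proof.
elim: b => // b IHb; rewrite ltnS => le_ab lt_b.
have lt_bin : 'C(N, b) < 'C(N, b.+1).
  have := mul_bin_left N b; have : 0 < 'C(N, b) by rewrite bin_gt0; lia.
  have : b.+1 < N - b by lia.
  move: 'C(N, b) 'C(N, b.+1) => u v; nia.
move: le_ab; rewrite leq_eqVlt => /orP[/eqP->// | lt_ab].
by rewrite (ltn_trans _ lt_bin) // IHb //; lia.
Qed.

Lemma leq_bin_half N a : 'C(N, a) <= 'C(N, N./2).
Proof.
have [le_aN|lt_Na] := leqP a N; last by rewrite bin_small.
have [|lt_ha] := leqP a N./2.
  by rewrite leq_eqVlt => /orP[/eqP->//|/ltn_bin_half/(_ (leqnn _))/ltnW].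
rewrite -(bin_sub le_aN).
have : N - a <= N./2 by lia.
by rewrite leq_eqVlt => /orP[/eqP->//|/ltn_bin_half/(_ (leqnn _))/ltnW].
Qed.

(** The symmetry of the row folds every index onto the lower half, where the coefficients increase
    strictly up to [g]. For odd [N] one has [g = N./2], and the bound is again the central value. *)
Lemma leqif_bin_second N a :
  a <= N -> a != N./2 ->
  'C(N, a) <= 'C(N, N./2.+1) ?= iff (a \in [:: N./2.+1; N - N./2.+1]).
Proof.
move=> le_aN a_h; set g := N - N./2.+1.
have [N0|N0] := posnP N; first by exfalso; lia.
have -> : 'C(N, N./2.+1) = 'C(N, g) by rewrite bin_sub //; lia.
have key b : b <= g -> 'C(N, b) <= 'C(N, g) ?= iff (b == g).
  rewrite leq_eqVlt => /orP[/eqP-> | lt_b]; first by split; rewrite ?eqxx.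
  have lt := @ltn_bin_half N b g lt_b ltac:(lia).
  by split; [exact: ltnW|rewrite !ltn_eqF].
have [le_ah|lt_ha] := leqP a N./2.
  have -> : (a \in [:: N./2.+1; g]) = (a == g) by rewrite !inE; lia.
  by apply: key; lia.
have -> : (a \in [:: N./2.+1; g]) = (N - a == g) by rewrite !inE; lia.
by rewrite -(bin_sub le_aN); apply: key; lia.
Qed.

Lemma ltn_bin_second N s a : 2 < N -> s < N -> 'C(s, a) < 'C(N, N./2.+1).
Proof.
case: N => // N N2; rewrite ltnS => le_sN.
have -> : 'C(N.+1, N.+1./2.+1) = 'C(N.+1, N./2).
  by rewrite -bin_sub; [congr 'C(_, _); lia | lia].
apply: (leq_ltn_trans (leq_bin2l a le_sN)).
apply: (leq_ltn_trans (leq_bin_half N a)).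
(* Since [N./2] is positive, Pascal's rule adds a nonzero second term; this gives strictness, which
   fails in row 2. *)
case eg: N./2 => [|g]; first by exfalso; lia.
by rewrite binS -[ltnLHS]addn0 ltn_add2l bin_gt0; lia.
Qed.

(** * The bound for families of disjoint pairs *)

Section Family.

Variables (N k : nat) (A B : 'I_k -> {set 'I_N}).
Hypothesis disjAB : forall i, [disjoint A i & B i].
Hypothesis no_triple : forall i j l, i != j -> j != l ->
  [disjoint A i & B j] -> [disjoint A j & B l] -> [disjoint A i & B l] -> False.

(** The hypothesis [no_triple] allows [l = i]. *)
Lemma antisym i j :
  i != j -> [disjoint A i & B j] -> [disjoint A j & B i] -> False.
Proof.
by move=> ij dij dji; apply: (no_triple (l := i) ij) => //; rewrite eq_sym.
Qed.

Let h := N./2.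
Let W := 'C(N, h).
Let W' := 'C(N, h.+1).

Let on p := [set i | before p (A i) (B i)].
Let c i := #|[set p | before p (A i) (B i)]|.
Let full i := #|A i| + #|B i| == N.
Let mid i := full i && (#|A i| == h).

(* On a given p the indices are linearly preordered by the position of the last
   element of A i, and i below j entails [disjoint A i & B j]; so antisymmetry
   and the absence of transitive triples leave room for two indices only. *)
Lemma card_on p : #|on p| <= 2.
Proof.
(* The successor turns [m i <= p x] into the statement that [A i] ends before [x], and leaves the
   value 0 for an empty [A i]. *)
pose m i := \max_(x in A i) (p x).+1.
have m_le i x : x \in A i -> p x < m i by move=> xA; apply: leq_bigmax_cond.
have disj i j : j \in on p -> m i <= m j -> [disjoint A i & B j].
  rewrite inE => /beforeP bj le_m; apply/pred0P => x /=.
  apply/negP => /andP[xA xB].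
  have : m j <= p x by apply/bigmax_leqP => y yA; apply: bj.
  by have := m_le i x xA; lia.
have chain i j l : i != j -> j != l -> j \in on p -> l \in on p ->
    m i <= m j -> m j <= m l -> False.
  move=> ij jl jp lp le1 le2; apply: (no_triple ij jl); apply: disj => //.
  exact: leq_trans le2.
rewrite leqNgt; apply/card_gt2P => -[x [y [z [[xp yp zp] [xy yz zx]]]]].
have [yx zy xz] : [/\ y != x, z != y & x != z].
  by rewrite eq_sym xy eq_sym yz eq_sym zx.
have [le_xy|/ltnW le_xy] := leqP (m x) (m y);
have [le_yz|/ltnW le_yz] := leqP (m y) (m z);
have [le_xz|/ltnW le_xz] := leqP (m x) (m z).
- exact: (chain x y z).
- exact: (chain x y z).
- exact: (chain x z y).
- exact: (chain z x y).
- exact: (chain y x z).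
- exact: (chain y z x).
- exact: (chain z y x).
- exact: (chain z y x).
Qed.

Lemma sum_c : \sum_i c i = \sum_p #|on p|.
Proof.
rewrite /c; under eq_bigr do rewrite -sum1dep_card.
rewrite (exchange_big_dep predT) //=; apply: eq_bigr => p _.
by rewrite sum1dep_card.
Qed.

Lemma sum_c_le : \sum_i c i <= 2 * N`!.
Proof.
rewrite sum_c -card_Sn mulnC -sum_nat_const.
by apply: leq_sum => p _; apply: card_on.
Qed.

Lemma c_bin i : c i * 'C(#|A i| + #|B i|, #|A i|) = N`!.
Proof. exact: card_before. Qed.

Lemma cardAB i : #|A i| + #|B i| <= N.
Proof.
have := max_card (A i :|: B i).
by rewrite cardsU disjoint_setI0 // cards0 subn0 card_ord.
Qed.

Lemma fullE i : full i -> B i = ~: A i.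
Proof.
move/eqP => cAB; apply/eqP; rewrite eqEcard -disjoints_subset disjoint_sym disjAB.
by have := cardsC (A i); rewrite card_ord; lia.
Qed.

(** Two full indices with equal [A] also have equal [B], hence violate [antisym]. *)
Lemma full_inj : {in full &, injective A}.
Proof.
move=> i j fi fj eA; apply/eqP; apply/negPn/negP => ij.
by apply: (antisym ij); rewrite ?fullE // eA -fullE.
Qed.

Lemma mid_inj : {in mid &, injective A}.
Proof. by move=> i j /andP[fi _] /andP[fj _]; apply: full_inj. Qed.

Lemma card_mid : #|mid| <= W.
Proof.
rewrite -(card_in_imset mid_inj) /W -[N in 'C(N, _)]card_ord -card_draws.
apply: subset_leq_card; apply/subsetP => S /imsetP[i /andP[_ ci] ->].
by rewrite inE.
Qed.

Hypothesis N2 : 2 < N.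

Lemma bin_nonmid i : ~~ mid i ->
  'C(#|A i| + #|B i|, #|A i|) <= W'
    ?= iff (full i && (#|A i| \in [:: h.+1; N - h.+1])).
Proof.
rewrite /mid /full; have [-> /= nh|lt _ /=] := eqVneq (_ + _) N.
  by apply: leqif_bin_second => //; apply: leq_trans (cardAB i); apply: leq_addr.
have lt_W : 'C(#|A i| + #|B i|, #|A i|) < W'.
  by apply: ltn_bin_second => //; rewrite ltn_neqAle lt cardAB.
by split; [exact: ltnW | rewrite ltn_eqF].
Qed.

Lemma W'_gt0 : 0 < W'.
Proof. by rewrite bin_gt0 /h; lia. Qed.

Lemma W'_le : W' <= W.
Proof. exact: leq_bin_half. Qed.

Lemma c_mid i : mid i -> c i * W = N`!.
Proof. by case/andP=> /eqP f /eqP e; rewrite -(c_bin i) f e. Qed.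

Lemma c_nonmid i : ~~ mid i -> N`! <= c i * W'.
Proof.
move=> nm; rewrite -(c_bin i) leq_mul2l.
by have [-> _] := bin_nonmid nm; rewrite orbT.
Qed.

Lemma card_mid_compl : #|mid| + #|predC mid| = k.
Proof. by rewrite cardC card_ord. Qed.

Lemma sum_mid : (\sum_(i | mid i) c i) * W = #|mid| * N`!.
Proof.
rewrite big_distrl /= -sum_nat_const.
by apply: eq_bigr => i; apply: c_mid.
Qed.

Lemma sum_nonmid : #|predC mid| * N`! <= (\sum_(i | ~~ mid i) c i) * W'.
Proof.
rewrite big_distrl /= -sum_nat_const.
by apply: leq_sum => i; apply: c_nonmid.
Qed.

(** This is [t / W + t' / W' <= 2] cleared of denominators, where [t] and [t'] count the indices
    inside and outside [mid]. *)
Lemma weighted_count : #|mid| * W' + #|predC mid| * W <= 2 * (W * W').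
Proof.
have := sum_mid; have := sum_nonmid; have := sum_c_le.
rewrite (bigID mid) /= => S1 S2 S3; have := fact_gt0 N.
move: S1 S2 S3; move: (\sum_(i | mid i) _) (\sum_(i | ~~ mid i) _) => a b.
move: #|mid| #|predC mid| N`! => t t' M S1 S2 S3 M0.
rewrite -(leq_pmul2r M0).
have E1 : t * W' * M = a * W * W' by rewrite S3; ring.
have E2 : t' * W * M <= b * W' * W by rewrite mulnAC leq_mul2r S2 orbT.
have E3 : (a + b) * (W * W') <= 2 * M * (W * W') by rewrite leq_mul2r S1 orbT.
rewrite mulnDl E1; nia.
Qed.

Lemma family_bound : k <= W + W'.
Proof.
have := weighted_count; have := card_mid; have := card_mid_compl.
have := W'_le; have := W'_gt0.
move: #|mid| #|predC mid| W W' => t t' w w' w0 ww' <- tw H.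
rewrite leqNgt; apply/negP => lt.
have : t * w' + (w + w' - t).+1 * w <= 2 * (w * w').
  by apply: leq_trans H; rewrite leq_add2l leq_mul2r; lia.
(* The inequality rearranges to [(w - w') * (w - t) + w <= 0], absurd because [w' <= w], [t <= w]
   and [0 < w]. *)
nia.
Qed.

(** * The case of equality *)

Section Equality.

Hypothesis keq : k = W + W'.

Lemma count_tight : #|mid| * W' + #|predC mid| * W = 2 * (W * W').
Proof.
apply/eqP; rewrite eqn_leq weighted_count /=.
have := card_mid; have := card_mid_compl; have := keq; have := W'_le.
move: #|mid| #|predC mid| W W' => t t' w w' ww' ek e tw.
have -> : t' = w + w' - t by lia.
(* The left side minus [2 * (w * w')] is [(w - w') * (w - t)], which is nonnegative. *)
nia.
Qed.

(** The weighted count adds up the bounds on the sums of [c]; equality in it leaves no slack in any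
    of them. *)
Lemma sum_tight :
  \sum_i c i = 2 * N`! /\ (\sum_(i | ~~ mid i) c i) * W' = #|predC mid| * N`!.
Proof.
have := sum_mid; have := sum_nonmid; have := sum_c_le; have := count_tight.
rewrite (bigID mid) /=; have := fact_gt0 N; have := W'_gt0; have := W'_le.
move: (\sum_(i | mid i) _) (\sum_(i | ~~ mid i) _) => a b.
move: #|mid| #|predC mid| N`! W W' => t t' M w w' ww' w0 M0 E S1 S2 S3.
have E1 : t * w' * M = a * w * w' by rewrite S3; ring.
have E2 : t' * w * M <= b * w' * w by rewrite mulnAC leq_mul2r S2 orbT.
have E3 : (a + b) * (w * w') <= 2 * M * (w * w') by rewrite leq_mul2r S1 orbT.
have E4 : t * w' * M + t' * w * M = 2 * M * (w * w').
  by rewrite -mulnDl E; ring.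
have P : 0 < w * w' by rewrite muln_gt0; lia.
split; apply/eqP.
  by rewrite -(eqn_pmul2r P) eqn_leq E3 /=; lia.
have w_gt0 : 0 < w by lia.
by rewrite -(eqn_pmul2r w_gt0) mulnAC [_ * M * w]mulnAC; lia.
Qed.

(** The average over all [p] is 2 and no term exceeds 2. *)
Lemma card_on_eq p : #|on p| = 2.
Proof.
have [E _] := sum_tight; move: E.
rewrite sum_c -card_Sn mulnC -sum_nat_const => E.
have L := @leqif_sum {perm 'I_N} xpredT (fun p => #|on p| == 2)
  (fun p => #|on p|) (fun=> 2) (fun p _ => conj (card_on p) (erefl _)).
by have [_] := L; rewrite E eqxx => /esym/forall_inP/(_ p isT)/eqP.
Qed.

(** A tight sum makes [c_nonmid] tight for each index, and the equality case of [bin_nonmid] then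
    fixes the size. *)
Lemma nonmid_level i : ~~ mid i -> full i && (#|A i| \in [:: h.+1; N - h.+1]).
Proof.
move=> nmi; have [_ <-] := bin_nonmid nmi.
have L := @leqif_sum _ (fun i => ~~ mid i) (fun i => N`! == c i * W')
  (fun=> N`!) (fun i => c i * W') (fun i nm => conj (c_nonmid nm) (erefl _)).
have [_] := L; rewrite sum_nat_const -big_distrl /=.
have [_ ->] := sum_tight; rewrite eqxx => /esym/forall_inP/(_ i nmi).
rewrite -(c_bin i) eqn_mul2l => /orP[/eqP c0|//].
by have := c_bin i; rewrite c0 mul0n; have := fact_gt0 N; lia.
Qed.

Lemma all_full i : full i.
Proof.
by have [/andP[]//|/nonmid_level/andP[]] := boolP (mid i).
Qed.

Lemma A_inj : injective A.
Proof. by move=> i j; apply: full_inj; apply: all_full. Qed.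

Lemma B_compl i : B i = ~: A i.
Proof. exact/fullE/all_full. Qed.

(** For full pairs, lying on [p] means that [A i] is an initial segment of [p], determined by its
    size. *)
Lemma on_initial p i (S : {set 'I_N}) :
  i \in on p -> before p S (~: S) -> #|A i| = #|S| -> A i = S.
Proof.
rewrite inE B_compl -!setTD => bi bS eq.
by apply: (initial_unique _ _ eq bi bS); apply: subsetT.
Qed.

Lemma level_cases i : #|A i| = h \/ #|A i| = h.+1 \/ #|A i| = N - h.+1.
Proof.
have [/andP[_ /eqP]|/nonmid_level/andP[_]] := boolP (mid i); first by left.
by rewrite !inE => /orP[]/eqP; right; [left|right].
Qed.

(** * Even ground sets: the two outer levels exclude each other *)

Section Even.

Hypothesis Neven : N = h.*2.

Lemma W'_lt : W' < W.
Proof.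
have -> : W' = 'C(N, h.-1).
  by rewrite /W' -bin_sub; [congr 'C(_, _); lia | lia].
by apply: ltn_bin_half => //; lia.
Qed.

(** Tightness reads [(W - W') * (W - t) = 0] with [t = #|mid|], and [W' < W] forces [t = W]. *)
Lemma mid_onto (S : {set 'I_N}) : #|S| = h -> exists i, A i = S.
Proof.
have E : #|mid| = W.
  have := count_tight; have := card_mid; have := card_mid_compl; have := keq.
  have := W'_lt; move: #|mid| #|predC mid| W W' => t t' w w' ww' ek e tw.
  have -> : t' = w + w' - t by lia.
  nia.
move=> cS.
have : A @: mid == [set S : {set 'I_N} | #|S| == h].
  rewrite eqEcard card_draws card_ord (card_in_imset mid_inj) E leqnn andbT.
  by apply/subsetP => _ /imsetP[i /andP[_ ci] ->]; rewrite inE.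
move/eqP/setP/(_ S); rewrite inE cS eqxx => /imsetP[i _ ->].
by exists i.
Qed.

(** A set of size [h] in between is present by [mid_onto] and would complete a forbidden triple. *)
Lemma low_high_incomparable i j : #|A i| = h.-1 -> #|A j| = h.+1 ->
  ~~ (A i \subset A j).
Proof.
move=> ci cj; apply/negP => sij.
have [x] : exists x, x \in A j :\: A i.
  by apply/card_gt0P; rewrite cardsD (setIidPr sij) ci cj; lia.
rewrite inE => /andP[xi xj].
have [l Al] : exists l, A l = x |: A i.
  by apply: mid_onto; rewrite cardsU1 xi ci; lia.
apply: (@no_triple i l j).
- by apply/eqP=> e; move: xi; rewrite e Al !inE eqxx.
- apply/eqP=> e; have := congr1 (fun s : {set _} => #|s|) Al.
  by rewrite e cj cardsU1 xi ci; lia.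
- by rewrite B_compl Al disjoints_subset setCK subsetUr.
- by rewrite B_compl Al disjoints_subset setCK subUset sub1set xj.
- by rewrite B_compl disjoints_subset setCK.
Qed.

(* If the lower set U is present and V contains U with |V| = |U| + 2, then V is
   absent, and the exactly-two property of a p through U' and V, for another U'
   inside V, forces U' to be present. *)
Lemma low_onto i (S : {set 'I_N}) :
  #|A i| = h.-1 -> #|S| = h.-1 -> exists j, A j = S.
Proof.
move=> ci cS.
suff [] : exists2 j, #|A j| = h.-1 & A j = S by move=> j; exists j.
pose P (S : {set 'I_N}) := exists2 j, #|A j| = h.-1 & A j = S.
apply: (@swap_ind _ setT P _ (A i) S) => //; last by exists i.
- move=> S1 x y _ + _ + [j cj eS1]; rewrite -eS1 {S cS S1 eS1} => xS yS.
  set S := y |: A j :\ x; have eh : N - h.+1 = h.-1 by lia.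
  have cS : #|S| = h.-1.
    by rewrite cardsU1 !inE negb_and yS orbT -cj (cardsD1 x (A j)) xS.
  have [z] : exists z, z \in ~: (y |: A j).
    by apply/card_gt0P; rewrite cardsCs setCK card_ord cardsU1 yS cj; lia.
  rewrite !inE negb_or => /andP[zy zA].
  pose V := z |: (y |: A j).
  have cV : #|V| = h.+1 by rewrite !cardsU1 !inE negb_or zy zA yS cj; lia.
  have sSV : S \subset V.
    by apply/subsetP=> t; rewrite !inE => /orP[->|/andP[_ ->]]; rewrite !orbT.
  have [p /andP[pS pV]] := perm_through sSV.
  have /eqP/cards2P[a [b [ab eon]]] := card_on_eq p.
  have key l : l \in on p -> #|A l| != h -> P S.
    move=> lp lh; have [e|[e|e]] := level_cases l.
    + by rewrite e eqxx in lh.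
    + have e' : A l = V by apply: (on_initial lp pV); rewrite e.
      have := low_high_incomparable cj e; rewrite e' /V setUA subsetUr //.
    + have eS : A l = S by apply: (on_initial lp pS); rewrite e cS eh.
      by exists l; rewrite // eS.
  have [aon bon] : a \in on p /\ b \in on p by rewrite eon !inE !eqxx orbT.
  (* Two members of size [h] on [p] would be the same initial segment, so [a] or [b] has another
     size and [key] applies. *)
  have [ea|] := eqVneq #|A a| h; last exact: key.
  have [eb|] := eqVneq #|A b| h; last exact: key.
  case/negP: ab; apply/eqP/A_inj.
  have := bon; rewrite inE B_compl => bb.
  by apply: (on_initial aon bb); rewrite ea.
- by rewrite ci.
Qed.

Lemma low_or_high i j : #|A i| = h.-1 -> #|A j| = h.+1 -> False.
Proof.
move=> ci cj.
(* The identity permutation is an arbitrary choice that serves to pick a subset of [A j] of size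
   [h.-1]; [low_onto] makes it present. *)
have [S /andP[sS /eqP cS]] := @initial_exists N 1%g (A j) h.-1 ltac:(lia).
have [l el] := low_onto ci cS.
by have := @low_high_incomparable l j; rewrite el cS cj sS => /(_ erefl erefl).
Qed.

End Even.

(** For odd [N] the sizes [N - h.+1] and [h] coincide; for even [N] the choice depends on whether
    size [h.+1] occurs. *)
Lemma two_level_family :
  (forall i, #|A i| \in [:: h; h.+1]) \/ (forall i, #|A i| \in [:: N - h.+1; h]).
Proof.
have [Nodd|Neven] : N = h.*2.+1 \/ N = h.*2 by rewrite /h; lia.
  by left=> i; have := level_cases i; rewrite !inE; lia.
have [/existsP[i /eqP ci]|/existsPn Hno] := boolP [exists i, #|A i| == h.+1].
  left=> j; have := level_cases j; rewrite !inE.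
  by have := @low_or_high Neven j i; lia.
by right=> j; have := level_cases j; have := Hno j; rewrite !inE; lia.
Qed.

End Equality.

End Family.

(** * From signed sets to their positive parts *)

Section SignedFamily.

Variable n : nat.
Implicit Type x : 'rV[int]_n.+1.

Lemma pos_neg_disjoint x : [disjoint pos_part x & neg_part x].
Proof.
by apply/pred0P => i; rewrite !inE; case: eqP => // ->.
Qed.

Lemma card_pos_neg x :
  signed_set x -> #|pos_part x| + #|neg_part x| + #|zero_part x| = n.+1.
Proof.
move=> /forallP sx.
rewrite -cardsUI disjoint_setI0 ?pos_neg_disjoint // cards0 addn0.
have -> : zero_part x = ~: (pos_part x :|: neg_part x).
  by apply/setP=> i; have := sx i; rewrite !inE => /or3P[]/eqP->.
by rewrite cardsC card_ord.
Qed.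

Lemma zero_part_full x :
  signed_set x -> #|pos_part x| + #|neg_part x| = n.+1 -> zero_part x == set0.
Proof. by move/card_pos_neg => + E; rewrite E -cards_eq0; lia. Qed.

Lemma pos_part_inj x y :
  signed_set x -> signed_set y -> zero_part x == set0 -> zero_part y == set0 ->
  pos_part x = pos_part y -> x = y.
Proof.
move=> /forallP sx /forallP sy /eqP/setP zx /eqP/setP zy /setP exy.
apply/rowP => i.
move: (sx i) (sy i) (zx i) (zy i) (exy i); rewrite !inE.
by case/or3P=> /eqP-> /or3P[]/eqP->.
Qed.

Lemma two_levels_surj r s (S : {set 'I_n.+1}) :
  0 < r <= n -> 0 < s <= n -> #|S| \in [:: r; s] ->
  exists2 x, x \in two_levels n r s & pos_part x = S.
Proof.
move=> hr hs cS; pose x := (\row_i (if i \in S then 1 else -1))%R : 'rV[int]_n.+1.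
have pS : pos_part x = S by apply/setP=> i; rewrite inE mxE; case: ifP.
have nS : neg_part x = ~: S by apply/setP=> i; rewrite !inE mxE; case: ifP.
have zS : zero_part x = set0 by apply/setP=> i; rewrite !inE mxE; case: ifP.
have sx : signed_set x by apply/forallP => i; rewrite !inE mxE; case: ifP.
exists x => //; apply/and3P; split; rewrite ?zS ?pS //.
apply/andP; split=> //; apply/orP; left; rewrite pS nS -!card_gt0.
have := cardsC S; rewrite card_ord.
by move: cS; rewrite !inE; lia.
Qed.

Lemma card_two_sizes r s : r != s ->
  #|[set S : {set 'I_n.+1} | #|S| \in [:: r; s]]| = 'C(n.+1, r) + 'C(n.+1, s).
Proof.
move=> rs; rewrite -[n.+1 in RHS]card_ord -!card_draws -cardsUI.
have -> : [set S : {set 'I_n.+1} | #|S| == r]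
    :&: [set S : {set 'I_n.+1} | #|S| == s] = set0.
  by apply/setP=> S; rewrite !inE; case: eqP => // ->; rewrite (negPf rs).
by rewrite cards0 addn0; apply: eq_card => S; rewrite !inE.
Qed.

Variables (k : nat) (X : 'I_k -> 'rV[int]_n.+1).

Lemma consists_of_card r s : r != s -> 0 < r <= n -> 0 < s <= n ->
  consists_of X (two_levels n r s) -> k = 'C(n.+1, r) + 'C(n.+1, s).
Proof.
move=> rs hr hs [injX codX]; rewrite -card_two_sizes //.
have XP i : X i \in two_levels n r s by rewrite -codX codom_f.
have inj : injective (fun i => pos_part (X i)).
  move=> i j; move: (XP i) (XP j).
  move=> /and3P[/andP[si _] zi _] /and3P[/andP[sj _] zj _].
  by move/(pos_part_inj si sj zi zj)/injX.
rewrite -[LHS]card_ord -(card_imset _ inj); apply: eq_card => S; rewrite inE.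
apply/imsetP/idP => [[i _ ->]|cS]; first by have /and3P[] := XP i.
have [x] := two_levels_surj hr hs cS; rewrite -codX => /codomP[i ->] <-.
by exists i.
Qed.

(** An injection into the sets of the two sizes that has as many values as there are such sets is
    onto, and a vector without zeros is recovered from its positive part. *)
Lemma consists_of_levels r s : injective (fun i => pos_part (X i)) -> r != s ->
  (forall i, X i \in two_levels n r s) -> k = 'C(n.+1, r) + 'C(n.+1, s) ->
  consists_of X (two_levels n r s).
Proof.
move=> inj rs XP ek; split.
  by move=> i j eX; apply: inj; rewrite eX.
move=> x; apply/codomP/idP => [[i ->]//|xP].
have : [set pos_part (X i) | i in 'I_k] ==
    [set S : {set 'I_n.+1} | #|S| \in [:: r; s]].
  rewrite eqEcard card_two_sizes // card_imset // card_ord -ek leqnn andbT.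
  by apply/subsetP => _ /imsetP[i _ ->]; rewrite inE; have /and3P[] := XP i.
have /and3P[/andP[sx _] zx cx] := xP.
move/eqP/setP/(_ (pos_part x)); rewrite inE cx => /imsetP[i _ e].
have /and3P[/andP[si _] zi _] := XP i.
by exists i; apply: pos_part_inj.
Qed.

End SignedFamily.

Theorem theorem23 (n : nat) (hn : 2 <= n) (k : nat)
    (X : 'I_k -> 'rV[int]_n.+1)
    (hZ : forall i : 'I_k, X i \in Zn n)
    (hX : admissible X) :
  k <= 'C(n.+2, n.+2./2) /\
  (k = 'C(n.+2, n.+2./2) <->
     consists_of X (two_levels n n.+1./2 (n.+1./2).+1) \/
     consists_of X (two_levels n (uphalf n.+1).-1 (uphalf n.+1))).
Proof.
pose A i := pos_part (X i); pose B i := neg_part (X i).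
have dAB i : [disjoint A i & B i] by apply: pos_neg_disjoint.
have triple i j l : i != j -> j != l -> [disjoint A i & B j] ->
    [disjoint A j & B l] -> [disjoint A i & B l] -> False.
  (* With the first two indices both [j], the index sets are disjoint even if [i = l], and the union
     condition splits into the three assumed disjointnesses and that of [A j] and [B j]. *)
  move=> ij jl dij djl dil; apply: hX; exists j, j, i, l; split.
    by apply/setP=> t; rewrite !inE orbb; case: eqP => //= ->;
      rewrite eq_sym (negPf ij) (negPf jl).
  by rewrite setIUl !setIUr !disjoint_setI0 ?setU0 //; apply: dAB.
have N2 : 2 < n.+1 by [].
pose h := n.+1./2; have eW1 : 'C(n.+2, n.+2./2) = 'C(n.+1, h) + 'C(n.+1, h.+1).
  by rewrite addnC -binS -[RHS]bin_sub /h; [congr 'C(_, _); lia | lia].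
have eW2 : 'C(n.+2, n.+2./2) = 'C(n.+1, n.+1 - h.+1) + 'C(n.+1, (n.+1 - h.+1).+1).
  by rewrite addnC -binS; congr 'C(_, _); rewrite /h; lia.
split; first by rewrite eW1; apply: (family_bound dAB triple).
have eu : uphalf n.+1 = (n.+1 - h.+1).+1 by rewrite /h; lia.
rewrite eu /=; split; last first.
  by case=> /consists_of_card ->; rewrite // /h; lia.
move=> ek; have ek1 := etrans ek eW1; have ek2 := etrans ek eW2.
have inj : injective A := A_inj dAB triple N2 ek1.
have XP r s : (forall i, #|A i| \in [:: r; s]) ->
    forall i, X i \in two_levels n r s.
  move=> cA i; rewrite inE hZ /= cA andbT; have /andP[si _] := hZ i.
  by apply: zero_part_full => //; apply/eqP/(all_full dAB triple N2 ek1).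
have [cA|cA] := two_level_family dAB triple N2 ek1; [left|right].
  by apply: consists_of_levels => //; [lia | apply: XP].
apply: consists_of_levels => //; [lia | apply: XP => i].
(* For even [n.+1] the size [h] is the upper level [n.+1 - h]; for odd [n.+1] it is the lower
   level. *)
by have := cA i; rewrite !inE /h; lia.
Qed.
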